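(* Let $T:V\to\mathfrak g$ be a $\Phi$-twisted Rota-Baxter operator on a 3-Leibniz algebra $(\mathfrak g,[\cdot,\cdot,\cdot]_{\mathfrak g})$ with respect to a representation $(V;\rho^l,\rho^m,\rho^r)$. Then there is an NS-3-Leibniz algebra structure on $V$ with trilinear operations given, for all $u,v,w\in V$, by $$[u,v,w]_{\triangleleft}=\rho^r(u,Tv,Tw),\quad [u,v,w]_{\triangle}=\rho^m(Tu,v,Tw),\quad [u,v,w]_{\triangleright}=\rho^l(Tu,Tv,w),\quad [u,v,w]_{\diamond}=\Phi(Tu,Tv,Tw).$$
   Context: All vector spaces are over an algebraically closed field $\mathbb K$ of characteristic $0$. A 3-Leibniz algebra is a vector space $\mathfrak g$ with a trilinear map $[\cdot,\cdot,\cdot]_{\mathfrak g}$ satisfying $[a,b,[x,y,z]_{\mathfrak g}]_{\mathfrak g}=[[a,b,x]_{\mathfrak g},y,z]_{\mathfrak g}+[x,[a,b,y]_{\mathfrak g},z]_{\mathfrak g}+[x,y,[a,b,z]_{\mathfrak g}]_{\mathfrak g}$. A representation of $\mathfrak g$ is a vector space $V$ with trilinear maps $\rho^l:\mathfrak g\otimes\mathfrak g\otimes V\to V$, $\rho^m:\mathfrak g\otimes V\otimes\mathfrak g\to V$, $\rho^r:V\otimes\mathfrak g\otimes\mathfrak g\to V$ such that for all $a,b,x,y,z\in\mathfrak g$, $u\in V$: $\rho^l(a,b,\rho^l(x,y,u))=\rho^l([a,b,x]_{\mathfrak g},y,u)+\rho^l(x,[a,b,y]_{\mathfrak g},u)+\rho^l(x,y,\rho^l(a,b,u))$;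 $\rho^l(a,b,\rho^m(x,u,z))=\rho^m([a,b,x]_{\mathfrak g},u,z)+\rho^m(x,\rho^l(a,b,u),z)+\rho^m(x,u,[a,b,z]_{\mathfrak g})$; $\rho^l(a,b,\rho^r(u,y,z))=\rho^r(\rho^l(a,b,u),y,z)+\rho^r(u,[a,b,y]_{\mathfrak g},z)+\rho^r(u,y,[a,b,z]_{\mathfrak g})$; $\rho^m(a,u,[x,y,z]_{\mathfrak g})=\rho^r(\rho^m(a,u,x),y,z)+\rho^m(x,\rho^m(a,u,y),z)+\rho^l(x,y,\rho^m(a,u,z))$; $\rho^r(u,b,[x,y,z]_{\mathfrak g})=\rho^r(\rho^r(u,b,x),y,z)+\rho^m(x,\rho^r(u,b,y),z)+\rho^l(x,y,\rho^r(u,b,z))$. $\Phi$ is a 2-cocycle: a trilinear map $\Phi:\mathfrak g\otimes\mathfrak g\otimes\mathfrak g\to V$ with $\Phi(a,b,[x,y,z]_{\mathfrak g})+\rho^l(a,b,\Phi(x,y,z))=\Phi([a,b,x]_{\mathfrak g},y,z)+\Phi(x,[a,b,y]_{\mathfrak g},z)+\Phi(x,y,[a,b,z]_{\mathfrak g})+\rho^l(x,y,\Phi(a,b,z))+\rho^m(x,\Phi(a,b,y),z)+\rho^r(\Phi(a,b,x),y,z)$. A linear map $T:V\to\mathfrak g$ is a $\Phi$-twisted Rota-Baxter operator if $[Tu,Tv,Tw]_{\mathfrak g}=T\big(\rho^l(Tu,Tv,w)+\rho^m(Tu,v,Tw)+\rho^r(u,Tv,Tw)+\Phi(Tu,Tv,Tw)\big)$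 for all $u,v,w\in V$. An NS-3-Leibniz algebra is a vector space $A$ with four trilinear maps $[\cdot,\cdot,\cdot]_{\triangleleft},[\cdot,\cdot,\cdot]_{\triangleright},[\cdot,\cdot,\cdot]_{\triangle},[\cdot,\cdot,\cdot]_{\diamond}:A\times A\times A\to A$ such that, with $[x,y,z]_\star=[x,y,z]_\triangleleft+[x,y,z]_\triangleright+[x,y,z]_\triangle+[x,y,z]_\diamond$, for all $a,b,x,y,z\in A$: (1) $[a,b,[x,y,z]_\triangleright]_\triangleright=[[a,b,x]_\star,y,z]_\triangleright+[x,[a,b,y]_\star,z]_\triangleright+[x,y,[a,b,z]_\triangleright]_\triangleright$; (2) $[a,b,[x,y,z]_\star]_\triangleleft=[[a,b,x]_\triangleleft,y,z]_\triangleleft+[x,[a,b,y]_\triangleleft,z]_\triangle+[x,y,[a,b,z]_\triangleleft]_\triangleright$; (3) $[a,b,[x,y,z]_\star]_\triangle=[[a,b,x]_\triangle,y,z]_\triangleleft+[x,[a,b,y]_\triangle,z]_\triangle+[x,y,[a,b,z]_\triangle]_\triangleright$; (4) $[a,b,[x,y,z]_\triangleleft]_\triangleright=[[a,b,x]_\triangleright,y,z]_\triangleleft+[x,[a,b,y]_\star,z]_\triangleleft+[x,y,[a,b,z]_\star]_\triangleleft$; (5) $[a,b,[x,y,z]_\triangle]_\triangleright=[[a,b,x]_\star,y,z]_\triangle+[x,[a,b,y]_\triangleright,z]_\triangle+[x,y,[a,b,z]_\star]_\triangle$; (6) $[a,b,[x,y,z]_\star]_\diamond+[a,b,[x,y,z]_\diamond]_\triangleright=[x,y,[a,b,z]_\diamond]_\triangleright+[x,y,[a,b,z]_\star]_\diamond+[x,[a,b,y]_\diamond,z]_\triangle+[x,[a,b,y]_\star,z]_\diamond+[[a,b,x]_\star,y,z]_\diamond+[[a,b,x]_\diamond,y,z]_\triangleleft$.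 *)

(* Defs.v *)
From HB Require Import structures.
From mathcomp Require Import all_boot all_order all_algebra.

Set Implicit Arguments.
Unset Strict Implicit.
Unset Printing Implicit Defensive.

Import GRing.Theory.
Local Open Scope ring_scope.

Definition trilinear (K : fieldType) (U1 U2 U3 W : lmodType K)
    (f : U1 -> U2 -> U3 -> W) : Prop :=
  [/\ forall y z, linear (fun x => f x y z),
      forall x z, linear (fun y => f x y z)
    & forall x y, linear (fun z => f x y z)].

Record is_3Leibniz (K : fieldType) (g : lmodType K) (br : g -> g -> g -> g)
    : Prop := Is3Leibniz {
  leib_trilinear : trilinear br;
  leib_fundamental : forall a b x y z,
    br a b (br x y z) =
      br (br a b x) y z + br x (br a b y) z + br x y (br a b z)
}.

Record is_representation (K : fieldType) (g V : lmodType K)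
    (br : g -> g -> g -> g)
    (rl : g -> g -> V -> V) (rm : g -> V -> g -> V) (rr : V -> g -> g -> V)
    : Prop := IsRepresentation {
  repr_l_trilinear : trilinear rl;
  repr_m_trilinear : trilinear rm;
  repr_r_trilinear : trilinear rr;
  repr_ll : forall a b x y u,
    rl a b (rl x y u) =
      rl (br a b x) y u + rl x (br a b y) u + rl x y (rl a b u);
  repr_lm : forall a b x u z,
    rl a b (rm x u z) =
      rm (br a b x) u z + rm x (rl a b u) z + rm x u (br a b z);
  repr_lr : forall a b u y z,
    rl a b (rr u y z) =
      rr (rl a b u) y z + rr u (br a b y) z + rr u y (br a b z);
  repr_m_br : forall a u x y z,
    rm a u (br x y z) =
      rr (rm a u x) y z + rm x (rm a u y) z + rl x y (rm a u z);
  repr_r_br : forall u b x y z,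
    rr u b (br x y z) =
      rr (rr u b x) y z + rm x (rr u b y) z + rl x y (rr u b z)
}.

Record is_2cocycle (K : fieldType) (g V : lmodType K)
    (br : g -> g -> g -> g)
    (rl : g -> g -> V -> V) (rm : g -> V -> g -> V) (rr : V -> g -> g -> V)
    (Phi : g -> g -> g -> V) : Prop := Is2Cocycle {
  cocycle_trilinear : trilinear Phi;
  cocycle_eq : forall a b x y z,
    Phi a b (br x y z) + rl a b (Phi x y z) =
      Phi (br a b x) y z + Phi x (br a b y) z + Phi x y (br a b z)
      + rl x y (Phi a b z) + rm x (Phi a b y) z + rr (Phi a b x) y z
}.

Definition is_twisted_RotaBaxter (K : fieldType) (g V : lmodType K)
    (br : g -> g -> g -> g)
    (rl : g -> g -> V -> V) (rm : g -> V -> g -> V) (rr : V -> g -> g -> V)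
    (Phi : g -> g -> g -> V) (T : {linear V -> g}) : Prop :=
  forall u v w : V,
    br (T u) (T v) (T w) =
      T (rl (T u) (T v) w + rm (T u) v (T w) + rr u (T v) (T w)
         + Phi (T u) (T v) (T w)).

(* The operations come in the order [,,]_triangleleft, [,,]_triangleright,
   [,,]_triangle, [,,]_diamond. *)
Definition NS_total (K : fieldType) (A : lmodType K)
    (lt rt mt dm : A -> A -> A -> A) (x y z : A) : A :=
  lt x y z + rt x y z + mt x y z + dm x y z.

Record is_NS3Leibniz (K : fieldType) (A : lmodType K)
    (lt rt mt dm : A -> A -> A -> A) : Prop := IsNS3Leibniz {
  NS_lt_trilinear : trilinear lt;
  NS_rt_trilinear : trilinear rt;
  NS_mt_trilinear : trilinear mt;
  NS_dm_trilinear : trilinear dm;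
  NS_eq1 : forall a b x y z, let st := NS_total lt rt mt dm in
    rt a b (rt x y z) =
      rt (st a b x) y z + rt x (st a b y) z + rt x y (rt a b z);
  NS_eq2 : forall a b x y z, let st := NS_total lt rt mt dm in
    lt a b (st x y z) =
      lt (lt a b x) y z + mt x (lt a b y) z + rt x y (lt a b z);
  NS_eq3 : forall a b x y z, let st := NS_total lt rt mt dm in
    mt a b (st x y z) =
      lt (mt a b x) y z + mt x (mt a b y) z + rt x y (mt a b z);
  NS_eq4 : forall a b x y z, let st := NS_total lt rt mt dm in
    rt a b (lt x y z) =
      lt (rt a b x) y z + lt x (st a b y) z + lt x y (st a b z);
  NS_eq5 : forall a b x y z, let st := NS_total lt rt mt dm in
    rt a b (mt x y z) =
      mt (st a b x) y z + mt x (rt a b y) z + mt x y (st a b z);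
  NS_eq6 : forall a b x y z, let st := NS_total lt rt mt dm in
    dm a b (st x y z) + rt a b (dm x y z) =
      rt x y (dm a b z) + dm x y (st a b z) + mt x (dm a b y) z
      + dm x (st a b y) z + dm (st a b x) y z + lt (dm a b x) y z
}.

(* Main.v *)
(** Twistedness says exactly that [T] intertwines the total operation on [V] with
    the bracket of [g].  The NS-3-Leibniz identities (1)-(5) are then the five
    axioms of a representation and (6) is the cocycle identity, all evaluated at
    elements of the image of [T]. *)

Require Import Defs.
From HB Require Import structures.
From mathcomp Require Import all_boot all_order all_algebra.

Set Implicit Arguments.
Unset Strict Implicit.
Unset Printing Implicit Defensive.

Import GRing.Theory.
Local Open Scope ring_scope.

(** Each operation on [V] is a structure map with [T] inserted in some slots, so its trilinearity is
    an instance of this. *)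
Lemma trilinear_comp (K : fieldType) (U1 U2 U3 U1' U2' U3' W : lmodType K)
    (f : U1 -> U2 -> U3 -> W) (p : {linear U1' -> U1})
    (q : {linear U2' -> U2}) (r : {linear U3' -> U3}) :
  trilinear f -> trilinear (fun x y z => f (p x) (q y) (r z)).
Proof.
case=> f1 f2 f3; split=> [y z|x z|x y] k u v; rewrite linearP.
- exact: f1.
- exact: f2.
- exact: f3.
Qed.

Lemma twisted_RotaBaxter_total (K : fieldType) (g V : lmodType K)
    (br : g -> g -> g -> g)
    (rl : g -> g -> V -> V) (rm : g -> V -> g -> V) (rr : V -> g -> g -> V)
    (Phi : g -> g -> g -> V) (T : {linear V -> g}) (u v w : V) :
  is_twisted_RotaBaxter br rl rm rr Phi T ->
  T (NS_total (fun u v w : V => rr u (T v) (T w))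
              (fun u v w : V => rl (T u) (T v) w)
              (fun u v w : V => rm (T u) v (T w))
              (fun u v w : V => Phi (T u) (T v) (T w)) u v w)
  = br (T u) (T v) (T w).
(* The two sums differ only in the place of the [rr] term: first in [NS_total], third in the twisted
   equation. *)
Proof. by move=> ->; rewrite /NS_total; congr (T (_ + _)); rewrite -addrA addrC. Qed.

Theorem theorem7p6 (K : closedFieldType) (charK0 : [pchar K] =i pred0)
    (g V : lmodType K) (br : g -> g -> g -> g)
    (rl : g -> g -> V -> V) (rm : g -> V -> g -> V) (rr : V -> g -> g -> V)
    (Phi : g -> g -> g -> V) (T : {linear V -> g})
    (g_leibniz : is_3Leibniz br)
    (V_repr : is_representation br rl rm rr)
    (Phi_cocycle : is_2cocycle br rl rm rr Phi)
    (T_twisted : is_twisted_RotaBaxter br rl rm rr Phi T) :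
  is_NS3Leibniz
    (fun u v w : V => rr u (T v) (T w))
    (fun u v w : V => rl (T u) (T v) w)
    (fun u v w : V => rm (T u) v (T w))
    (fun u v w : V => Phi (T u) (T v) (T w)).
Proof.
have Tst := twisted_RotaBaxter_total _ _ _ T_twisted.
split.
(* [idfun] marks the slot that takes a vector of [V] directly. *)
- exact: (trilinear_comp idfun T T (repr_r_trilinear V_repr)).
- exact: (trilinear_comp T T idfun (repr_l_trilinear V_repr)).
- exact: (trilinear_comp T idfun T (repr_m_trilinear V_repr)).
- exact: (trilinear_comp T T T (cocycle_trilinear Phi_cocycle)).
(* Every inner [st] sits in a slot of [g], hence under [T], where [Tst] makes it a bracket. *)
- by move=> a b x y z st; rewrite !Tst (repr_ll V_repr).
- by move=> a b x y z st; rewrite Tst (repr_r_br V_repr).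
- by move=> a b x y z st; rewrite Tst (repr_m_br V_repr).
- by move=> a b x y z st; rewrite !Tst (repr_lr V_repr).
- by move=> a b x y z st; rewrite !Tst (repr_lm V_repr).
- move=> a b x y z st; rewrite !Tst (cocycle_eq Phi_cocycle).
  (* Both sides now have the same six terms; the permutation brings the three [Phi] terms to the
     front. *)
  by rewrite [RHS](ACl (5*4*2*1*3*6)).
Qed.
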